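(* There exists an absolute constant $c$ such that the following holds. Let $n,B,Q\ge 1$ be integers, $\eta>0$, and let $A(k)=(a_{ij}(k))$, $k=0,1,2,\ldots$, be $n\times n$ matrices satisfying the non-vanishing weights assumption with constant $\eta$ and the double stochasticity assumption. Let $x(0)\in\mathbb{R}^n$ be such that every $x_i(0)$ is a multiple of $1/Q$, and let $$x_i(k+1)=\Big\lfloor\sum_{j=1}^n a_{ij}(k)x_j(k)\Big\rfloor,\qquad i=1,\ldots,n,\ k\ge 0,$$ where $\lfloor\cdot\rfloor$ denotes rounding down to the nearest multiple of $1/Q$. Suppose that the relaxed connectivity assumption (with constant $B$) holds for the matrices $A(k)$ and the generated sequence $x(k)$. Then for every $\epsilon>0$, $$\underline V(x(k))\le\epsilon\,\underline V(x(0))\qquad\text{for all integers }k\ge 0\text{ with }k\ge c\,\frac{n^2}{\eta}\,B\log(1/\epsilon).$$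
   Context: For $x\in\mathbb{R}^n$, $m(x)=\min_i x_i$ and $\underline V(x)=\sum_{i=1}^n(x_i-m(x))^2$. An absolute constant is one that does not depend on any of the parameters of the problem. Non-vanishing weights (constant $\eta>0$): for every $k$, $A(k)$ is nonnegative, row-stochastic, has positive diagonal entries, and $a_{ij}(k)>0$ implies $a_{ij}(k)>\eta$. Double stochasticity: for every $k$ and $j$, $\sum_{i=1}^n a_{ij}(k)=1$. Relaxed connectivity (constant $B$): for every integer $\ell\ge 0$, if the nodes are relabeled so that the components of $x(\ell B)$ are in nonincreasing order, $x_1(\ell B)\ge\cdots\ge x_n(\ell B)$, then for every $d\in\{1,\ldots,n-1\}$ either $x_d(\ell B)=x_{d+1}(\ell B)$, or there exist a time $s\in\{\ell B,\ldots,(\ell+1)B-1\}$ and indices $i\in\{1,\ldots,d\}$, $j\in\{d+1,\ldots,n\}$ such that $a_{ij}(s)>0$ or $a_{ji}(s)>0$.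
   Formalization: For ε < 1 the bound is claimed only for k ≥ B; as printed it fails for every c when ε is close to 1 and k < B (e.g. n = 2, B = 2, Q = 1, η = 1/4, A(0) = I, A(k) all entries 1/2 for k ≥ 1, x(0) = (1,0), k = 1). *)

(* Defs.v *)
From mathcomp Require Import all_boot all_order all_fingroup all_algebra.
From mathcomp Require Import reals sequences exp.

Set Implicit Arguments.
Unset Strict Implicit.
Unset Printing Implicit Defensive.

Import Order.TTheory GRing.Theory Num.Theory.
Local Open Scope ring_scope.

(* The default value [x ord0 ord0] of the big minimum is itself one of the
   entries, so [minc x] is the smallest entry; this needs dimension n.+1. *)
Definition minc (R : realType) (n : nat) (x : 'cV[R]_n.+1) : R :=
  \big[Num.min/x ord0 ord0]_(i < n.+1) x i ord0.

Definition Vlow (R : realType) (n : nat) (x : 'cV[R]_n.+1) : R :=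
  \sum_(i < n.+1) (x i ord0 - minc x) ^+ 2.

Definition nonvanishing_weights (R : realType) (n : nat) (eta : R)
    (A : nat -> 'M[R]_n) : Prop :=
  forall k : nat,
    [/\ forall i j, 0 <= A k i j,
        forall i, \sum_(j < n) A k i j = 1,
        forall i, 0 < A k i i
      & forall i j, 0 < A k i j -> eta < A k i j].

Definition column_stochastic (R : realType) (n : nat)
    (A : nat -> 'M[R]_n) : Prop :=
  forall (k : nat) (j : 'I_n), \sum_(i < n) A k i j = 1.

Definition quantum_multiple (R : realType) (Q : nat) (y : R) : Prop :=
  exists z : int, y = z%:~R / Q%:R.

Definition quantum_floor (R : realType) (Q : nat) (y : R) : R :=
  (Num.floor (Q%:R * y))%:~R / Q%:R.

Definition quantized_averaging (R : realType) (n : nat) (Q : nat)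
    (A : nat -> 'M[R]_n) (x : nat -> 'cV[R]_n) : Prop :=
  forall (k : nat) (i : 'I_n),
    x k.+1 i ord0 = quantum_floor Q (\sum_(j < n) A k i j * x k j ord0).

(* [s] is the relabeling: [s p] is the node placed at position [p].  Positions
   are counted from 0, so the cut between the first d and the remaining nodes
   lies between the consecutive positions [p] (= d - 1) and [q] (= d). *)
Definition relaxed_connectivity (R : realType) (n : nat) (B : nat)
    (A : nat -> 'M[R]_n) (x : nat -> 'cV[R]_n) : Prop :=
  forall (l : nat) (s : {perm 'I_n}),
    (forall p q : 'I_n, (p <= q)%N ->
       x (l * B)%N (s q) ord0 <= x (l * B)%N (s p) ord0) ->
    forall p q : 'I_n, q = p.+1 :> nat ->
      x (l * B)%N (s p) ord0 = x (l * B)%N (s q) ord0 \/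
      exists t : nat, (l * B <= t < l.+1 * B)%N /\
        exists i j : 'I_n, [/\ (i <= p)%N, (q <= j)%N &
          0 < A t (s i) (s j) \/ 0 < A t (s j) (s i)].

(* Main.v *)
(* The minimum never decreases, since it is a multiple of 1/Q, and rounding down
   moves every entry towards it; hence one step decreases [Vlow] by at least the
   total dispersion of the rows of A(k), as in the unquantized iteration.  Over
   a window of length B, sort the entries at its start.  Until nodes first
   communicate across the cut after position d, the values on the two sides
   stay separated by the initial gap g_d.  At that first crossing the rows
   disperse the indicator of the cut by at least eta / 2, so the window
   decreases [Vlow] by at least (eta / 2) * sum_d g_d^2, and by Cauchy-Schwarz
   sum_d g_d^2 >= Vlow / N^2 for N nodes. *)
Require Import Defs.
From mathcomp Require Import all_boot all_order all_fingroup all_algebra.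
From mathcomp Require Import reals sequences exp.
From mathcomp Require Import zify ring lra.

Set Implicit Arguments.
Unset Strict Implicit.
Unset Printing Implicit Defensive.

Import Order.TTheory GRing.Theory Num.Theory.
Local Open Scope ring_scope.

(** * Variance of a function under a weight vector *)

Section Dispersion.
Variables (R : realFieldType) (I : finType).
Implicit Types a u : I -> R.

(** For weights of total 1 this is the variance. The pairwise form is visibly nonnegative for
    nonnegative weights and allows comparisons pair by pair. *)
Definition dispersion a u : R :=
  (\sum_i \sum_j a i * a j * (u i - u j) ^+ 2) / 2.

Lemma dispersionE a u : \sum_i a i = 1 ->
  dispersion a u = \sum_i a i * u i ^+ 2 - (\sum_i a i * u i) ^+ 2.
Proof.
move=> a1; rewrite /dispersion.
set S2 := \sum_i a i * u i ^+ 2; set S1 := \sum_i a i * u i.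
suff -> : \sum_i \sum_j a i * a j * (u i - u j) ^+ 2 = S2 *+ 2 - S1 ^+ 2 *+ 2.
  by field.
transitivity (\sum_i (a i * u i ^+ 2 * \sum_j a j + a i * S2
                      - a i * u i * S1 *+ 2)).
  apply: eq_bigr => i _; rewrite /S1 /S2 !mulr_sumr -sumrMnl -sumrN -!big_split.
  by apply: eq_bigr => j _ /=; ring.
rewrite !big_split /= sumrN sumrMnl -!mulr_suml a1 -/S1 -/S2 mulr1 mul1r expr2.
by rewrite mulr2n.
Qed.

Lemma dispersion_ge0 a u : (forall i, 0 <= a i) -> 0 <= dispersion a u.
Proof.
move=> a0; apply: divr_ge0 => //; apply: sumr_ge0 => i _.
by apply: sumr_ge0 => j _; apply: mulr_ge0; rewrite ?sqr_ge0 ?mulr_ge0.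
Qed.

Lemma dispersion_translate a u c :
  dispersion a (fun i => u i - c) = dispersion a u.
Proof.
congr (_ / _); apply: eq_bigr => i _; apply: eq_bigr => j _.
by congr (_ * _ ^+ 2); ring.
Qed.

(** Both sides expand over the same pairs with weights [a i * a j], so the hypothesis settles each
    pair. It serves to split the values into indicators of cuts. *)
Lemma dispersion_sum_le (D : finType) (E : pred D) (g : D -> R)
    (v : D -> I -> R) a u :
    (forall i, 0 <= a i) ->
    (forall i j, \sum_(d | E d) g d * (v d i - v d j) ^+ 2
                 <= (u i - u j) ^+ 2) ->
  \sum_(d | E d) g d * dispersion a (v d) <= dispersion a u.
Proof.
move=> a0 le_vu; rewrite /dispersion.
under eq_bigr do rewrite mulrA.
rewrite -mulr_suml ler_pM2r ?invr_gt0 ?ltr0n //.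
under eq_bigr do rewrite mulr_sumr.
rewrite exchange_big /=; apply: ler_sum => i _.
under eq_bigr do rewrite mulr_sumr.
rewrite exchange_big /=; apply: ler_sum => j _.
apply: le_trans (ler_wpM2l _ (le_vu i j)); last by rewrite mulr_ge0.
rewrite mulr_sumr le_eqVlt; apply/orP; left; apply/eqP.
by apply: eq_bigr => d _; ring.
Qed.

(** With mass [C] on [P], the variance is [C * (1 - C)]; both factors exceed [eta] and the larger is
    at least 1/2. *)
Lemma dispersion_indicator a (P : pred I) (eta : R) i j :
    0 <= eta -> (forall i, 0 <= a i) -> \sum_i a i = 1 ->
    eta < a i -> eta < a j -> P i != P j ->
  eta / 2 <= dispersion a (fun i => (P i)%:R).
Proof.
move=> eta0 a0 a1 ai aj Pij; rewrite dispersionE //.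
have -> : \sum_i a i * (P i)%:R ^+ 2 = \sum_i a i * (P i)%:R.
  by apply: eq_bigr => k _; rewrite expr2 -natrM mulnb andbb.
have sumP (Q : pred I) : \sum_i a i * (Q i)%:R = \sum_(i | Q i) a i.
  by rewrite [RHS]big_mkcond; apply: eq_bigr => k _; case: (Q k);
    rewrite ?mulr1 ?mulr0.
rewrite sumP; set C := \sum_(i | P i) a i.
have CN : C + \sum_(i | ~~ P i) a i = 1 by rewrite -a1 [RHS](bigID P).
have le_sum (Q : pred I) k : Q k -> eta < a k -> eta < \sum_(i | Q i) a i.
  move=> Qk /lt_le_trans; apply; rewrite (bigD1 k) //= lerDl.
  exact: sumr_ge0.
have [C1 C2] : eta < C /\ eta < \sum_(i | ~~ P i) a i.
  case Pi: (P i) Pij; case Pj: (P j) => // _; split.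
  - exact: le_sum ai.
  - by apply: le_sum aj; rewrite Pj.
  - exact: le_sum aj.
  - by apply: le_sum ai; rewrite Pi.
move: C1 C2 CN; set C' := \sum_(i | ~~ P i) a i; clearbody C C'; nra.
Qed.

(** Cauchy-Schwarz, as nonnegativity of the variance under uniform weights; an empty [I] is treated
    apart, since those weights then do not sum to 1. *)
Lemma sumr_sqr_le (u : I -> R) :
  (\sum_i u i) ^+ 2 <= #|I|%:R * \sum_i u i ^+ 2.
Proof.
have [/eqP I0|I0] := eqVneq #|I| 0%N.
  rewrite !big_pred0; first by rewrite expr0n mulr0.
  - by move=> i; move/card0_eq: (eqP I0) => /(_ i).
  - by move=> i; move/card0_eq: (eqP I0) => /(_ i).
have N0 : 0 < #|I|%:R :> R by rewrite ltr0n lt0n.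
have := @dispersion_ge0 (fun=> #|I|%:R^-1) u (fun=> _).
rewrite invr_ge0 ler0n dispersionE; last first.
  by rewrite sumr_const -[LHS]mulr_natl divff ?gt_eqF.
rewrite -!mulr_sumr => /(_ (fun=> isT)) /(mulr_ge0 (ltW (exprn_gt0 2 N0))).
rewrite -[(\sum_i u i) ^+ 2 <= _]subr_ge0; congr (_ <= _); field; exact: lt0r_neq0.
Qed.

End Dispersion.

(** Only indices of positive weight need the bound, so that a node may ignore those it does not
    listen to. *)
Lemma avg_ge (R : realFieldType) (I : finType) (a u : I -> R) (m : R) :
    (forall i, 0 <= a i) -> \sum_i a i = 1 ->
    (forall i, 0 < a i -> m <= u i) ->
  m <= \sum_i a i * u i.
Proof.
move=> a0 a1 mu; rewrite -[m]mul1r -a1 mulr_suml; apply: ler_sum => i _.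
have := a0 i; rewrite le_eqVlt => /orP[/eqP<-|ai]; first by rewrite !mul0r.
by rewrite ler_pM2l ?mu.
Qed.

Lemma avg_le (R : realFieldType) (I : finType) (a u : I -> R) (m : R) :
    (forall i, 0 <= a i) -> \sum_i a i = 1 ->
    (forall i, 0 < a i -> u i <= m) ->
  \sum_i a i * u i <= m.
Proof.
move=> a0 a1 um; rewrite -[X in _ <= X]opprK -lerN2 opprK -sumrN.
under eq_bigr do rewrite -mulrN.
by apply: avg_ge => // i ai; rewrite lerN2 um.
Qed.

(** * Rounding down to multiples of 1/Q *)

Section Quantum.
Variables (R : realType) (Q : nat).
Hypothesis Q_gt0 : (0 < Q)%N.

Lemma quantum_floor_le (y : R) : quantum_floor Q y <= y.
Proof. by rewrite ler_pdivrMr ?ltr0n// mulrC floor_le. Qed.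

Lemma quantum_multiple_floor (y : R) : quantum_multiple Q (quantum_floor Q y).
Proof. by exists (Num.floor (Q%:R * y)). Qed.

Lemma quantum_floor_ge (m y : R) :
  quantum_multiple Q m -> m <= y -> m <= quantum_floor Q y.
Proof.
move=> [z ->]; rewrite ler_pdivrMr ?ltr0n// => zy.
by rewrite ler_pM2r ?invr_gt0 ?ltr0n// ler_int floor_ge_int mulrC.
Qed.

End Quantum.

(** * The minimum and the one-step decrease of [Vlow] *)

Section Vlow.
Variables (R : realType) (n : nat).
Implicit Types x : 'cV[R]_n.+1.

Lemma minc_le x i : minc x <= x i ord0.
Proof. exact: bigmin_le. Qed.

Lemma minc_ge x m : (forall i, m <= x i ord0) -> m <= minc x.
Proof. by move=> mx; apply/bigmin_geP. Qed.

Lemma minc_quantum Q x :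
  (forall i, quantum_multiple Q (x i ord0)) -> quantum_multiple Q (minc x).
Proof.
move=> qx; apply: (big_ind (quantum_multiple Q)) => // y z qy qz.
by case: leP.
Qed.

Lemma Vlow_le x m : m <= minc x -> Vlow x <= \sum_i (x i ord0 - m) ^+ 2.
Proof.
move=> mx; apply: ler_sum => i _; have mi := minc_le x i.
by rewrite ler_pXn2r // ?nnegrE ?subr_ge0 ?lerB // (le_trans mx mi).
Qed.

End Vlow.

Lemma dispersion_perm (R : realFieldType) (I : finType) (s : {perm I})
    (a u : I -> R) :
  dispersion (fun i => a (s i)) (fun i => u (s i)) = dispersion a u.
Proof.
congr (_ / _); rewrite [RHS](reindex_inj (@perm_inj _ s)).
by apply: eq_bigr => i _; rewrite [RHS](reindex_inj (@perm_inj _ s)).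
Qed.

(** Unit column sums turn [Vlow x] into a sum over rows of mean squared deviations from the old
    minimum; removing each row's variance leaves the squared deviation of its mean. *)
Lemma Vlow_step (R : realType) (n Q : nat) (M : 'M[R]_n.+1)
    (x x' : 'cV[R]_n.+1) :
    (0 < Q)%N -> (forall i j, 0 <= M i j) ->
    (forall i, \sum_j M i j = 1) -> (forall j, \sum_i M i j = 1) ->
    (forall i, quantum_multiple Q (x i ord0)) ->
    (forall i, x' i ord0 = quantum_floor Q (\sum_j M i j * x j ord0)) ->
  Vlow x' <= Vlow x - \sum_i dispersion (M i) (fun j => x j ord0).
Proof.
move=> Q0 M0 row1 col1 qx x'E; set m := minc x.
have mx' i : m <= x' i ord0.
  rewrite x'E; apply: quantum_floor_ge => //; first exact: minc_quantum.
  by apply: avg_ge => // j _; exact: minc_le.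
have avgB i : \sum_j M i j * (x j ord0 - m) = \sum_j M i j * x j ord0 - m.
  rewrite -[m in RHS]mul1r -(row1 i) mulr_suml -sumrB.
  by apply: eq_bigr => j _; rewrite mulrBr.
have -> : Vlow x - \sum_i dispersion (M i) (fun j => x j ord0)
          = \sum_i (\sum_j M i j * x j ord0 - m) ^+ 2.
  have -> : Vlow x = \sum_i \sum_j M i j * (x j ord0 - m) ^+ 2.
    rewrite exchange_big; apply: eq_bigr => j _.
    by rewrite -mulr_suml col1 mul1r.
  rewrite -sumrB; apply: eq_bigr => i _.
  rewrite -(dispersion_translate _ _ m) dispersionE // avgB.
  by rewrite opprB addrC subrK.
(* Measuring from the old minimum [m] instead of the new one only enlarges the squares. *)
apply: le_trans (Vlow_le (minc_ge mx')) _; apply: ler_sum => i _.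
have le_x' : x' i ord0 <= \sum_j M i j * x j ord0.
  by rewrite x'E quantum_floor_le.
rewrite ler_pXn2r ?nnegrE ?subr_ge0 ?lerB //.
exact: le_trans (mx' i) le_x'.
Qed.

(* If [E] is nonempty, the gaps indexed by [E] sum to at most [u - v], since the
   other gaps are nonnegative; and a sum of squares of nonnegative numbers is at
   most the square of their sum. *)
Lemma sum_gaps_sqr_le (R : realDomainType) (y : nat -> R) (E : pred nat)
    (N : nat) (u v : R) :
    (forall p q, (p <= q <= N)%N -> y q <= y p) ->
    (forall d, (d < N)%N -> E d -> y d <= u /\ v <= y d.+1) ->
  \sum_(d < N | E d) (y d - y d.+1) ^+ 2 <= (u - v) ^+ 2.
Proof.
elim: N v => [|N IHN] v y_mono Euv.
  by rewrite big_ord0 sqr_ge0.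
have y_mono' p q : (p <= q <= N)%N -> y q <= y p.
  by move=> /andP[pq qN]; rewrite y_mono // pq leqW.
rewrite big_mkcond big_ord_recr -big_mkcond /=.
case: ifPn => EN; last first.
  by rewrite addr0 IHN // => d dN; apply: Euv; rewrite ltnW.
have [yu vy] := Euv N (ltnSn N) EN.
have yN : y N.+1 <= y N by rewrite y_mono ?leqnn ?leqnSn.
(* The earlier gaps fit between [u] and [y N], leaving the rest of [u - v] for the last gap. *)
have : \sum_(d < N | E d) (y d - y d.+1) ^+ 2 <= (u - y N) ^+ 2.
  apply: IHN => // d dN /(Euv d (ltnW dN))[ydu _]; split=> //.
  by rewrite y_mono' // dN leqnn.
move: (\sum_(d < N | E d) _) => S; nra.
Qed.

(** * Decrease over one connectivity window *)

Section Window.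
Variables (R : realType) (n Q : nat) (eta : R).
Variables (A : nat -> 'M[R]_n.+1) (x : nat -> 'cV[R]_n.+1).
Hypothesis Q_gt0 : (0 < Q)%N.
Hypothesis eta_gt0 : 0 < eta.
Hypothesis A_weights : nonvanishing_weights eta A.
Hypothesis A_col : column_stochastic A.
Hypothesis x0_quantum : forall i, quantum_multiple Q (x 0%N i ord0).
Hypothesis x_step : quantized_averaging Q A x.

Let A_ge0 k i j : 0 <= A k i j.
Proof. by case: (A_weights k). Qed.

Let A_row k i : \sum_j A k i j = 1.
Proof. by case: (A_weights k). Qed.

Let A_gt_eta k i j : 0 < A k i j -> eta < A k i j.
Proof. by case: (A_weights k) => _ _ _; apply. Qed.

Let A_diag k i : eta < A k i i.
Proof. by apply: A_gt_eta; case: (A_weights k). Qed.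

Let x_quantum k i : quantum_multiple Q (x k i ord0).
Proof. by case: k => [//|k]; rewrite x_step; exact: quantum_multiple_floor. Qed.

Lemma Vlow_succ k :
  Vlow (x k.+1) <= Vlow (x k) - \sum_i dispersion (A k i) (fun j => x k j ord0).
Proof. by apply: Vlow_step (x_step k). Qed.

Lemma Vlow_nonincreasing k l : (k <= l)%N -> Vlow (x l) <= Vlow (x k).
Proof.
move=> /subnK <-; elim: (l - k)%N => // d IHd.
apply: le_trans IHd; apply: le_trans (Vlow_succ _) _.
by rewrite gerBl sumr_ge0 // => i _; exact: dispersion_ge0.
Qed.

Variables (T : nat) (s : {perm 'I_n.+1}).
Hypothesis s_sorts : forall p q : 'I_n.+1, (p <= q)%N ->
  x T (s q) ord0 <= x T (s p) ord0.

(** [inord] extends positions to all naturals, so gaps need no casts; only positions up to [n] are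
    meaningful. *)
Definition sorted_value (p : nat) : R := x T (s (inord p)) ord0.
Local Notation y := sorted_value.

Lemma sorted_value_mono p q : (p <= q <= n)%N -> y q <= y p.
Proof.
move=> /andP[pq qn]; apply: s_sorts.
by rewrite !inordK // ltnS // (leq_trans pq).
Qed.

Definition crossing (t d : nat) : bool :=
  [exists i : 'I_n.+1, exists j : 'I_n.+1,
    [&& (i <= d)%N, (d < j)%N &
      (0 < A t (s i) (s j)) || (0 < A t (s j) (s i))]].

(** The steps covered run from [T] to [T + t - 1], exactly those that lead from [x T] to
    [x (T + t)]. *)
Definition crossed (t d : nat) : bool :=
  has (fun t' => crossing (T + t') d) (iota 0 t).

Lemma crossedS t d : crossed t.+1 d = crossed t d || crossing (T + t) d.
Proof. by rewrite /crossed -addn1 iotaD has_cat /= orbF. Qed.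

Lemma crossingPn t d (i j : 'I_n.+1) :
    ~~ crossing t d -> (i <= d)%N != (j <= d)%N ->
  A t (s i) (s j) = 0.
Proof.
move=> ncr ij; apply/eqP; rewrite eq_le A_ge0 andbT leNgt; apply/negP => Aij.
case/negP: ncr; case: (leqP i d) ij => id; case: (leqP j d) => // jd _.
  by apply/existsP; exists i; apply/existsP; exists j; rewrite id jd Aij.
by apply/existsP; exists j; apply/existsP; exists i; rewrite id jd Aij orbT.
Qed.

(** Without weights across the cut, each node averages over its own side. Rounding down respects the
    lower bound because [y d], an entry of [x T], is a multiple of 1/Q. *)
Lemma uncrossed_separates t d (i : 'I_n.+1) :
    (d < n)%N -> ~~ crossed t d ->
  if (i <= d)%N then y d <= x (T + t)%N (s i) ord0
  else x (T + t)%N (s i) ord0 <= y d.+1.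
Proof.
move=> dn; elim: t i => [|t IHt] i.
  rewrite addn0 => _; case: leqP => id.
    by apply: s_sorts; rewrite inordK // ltnS ltnW.
  by apply: s_sorts; rewrite inordK.
rewrite crossedS negb_or => /andP[/IHt{}IHt ncr].
have same j : 0 < A (T + t)%N (s i) (s j) -> (i <= d)%N = (j <= d)%N.
  by case: (eqVneq (i <= d)%N (j <= d)%N) => // /(crossingPn ncr)->; rewrite ltxx.
rewrite addnS x_step (reindex_inj (@perm_inj _ s)) /=.
have row1 : \sum_j A (T + t)%N (s i) (s j) = 1.
  by rewrite -(A_row (T + t) (s i)) [RHS](reindex_inj (@perm_inj _ s)).
case: ifP => id.
  apply: quantum_floor_ge => //; first exact: x_quantum.
  apply: avg_ge => // j /same.
  by rewrite id => /esym jd; have := IHt j; rewrite jd.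
apply: le_trans (quantum_floor_le _ _) _ => //; apply: avg_le => // j /same.
by rewrite id => /esym jd; have := IHt j; rewrite jd.
Qed.

(** One row suffices: a node receiving from across the cut puts weight above [eta] both on its
    sender and, by the positive diagonal, on itself. *)
Lemma dispersion_crossing t d : crossing t d ->
  eta / 2 <= \sum_i dispersion (fun j => A t i (s j))
                      (fun j : 'I_n.+1 => (j <= d)%:R).
Proof.
have row1 i : \sum_j A t i (s j) = 1.
  by rewrite -(A_row t i) [RHS](reindex_inj (@perm_inj _ s)).
move=> /existsP[i /existsP[j /and3P[id dj Aij]]].
have [k [l [kl Akl]]] : exists k l : 'I_n.+1,
    (k <= d)%N != (l <= d)%N /\ 0 < A t (s k) (s l).
  case/orP: Aij => Aij; [exists i, j | exists j, i]; split=> //;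
  by rewrite id leqNgt dj.
rewrite (bigD1 (s k)) //= -[X in X <= _]addr0 lerD //; last first.
  by apply: sumr_ge0 => ? _; exact: dispersion_ge0.
apply: (@dispersion_indicator _ _ _ (fun j : 'I_n.+1 => (j <= d)%N) _ k l) => //.
- exact: ltW.
- exact: A_gt_eta.
Qed.

(** Cuts not crossed before still separate the values, so the gaps of those lying between two nodes
    fit disjointly into the difference of their values. This is the pairwise bound needed to
    superpose the indicators of all these cuts. *)
Lemma first_crossing_dispersion t :
  eta / 2 * \sum_(d < n | ~~ crossed t d && crossing (T + t) d)
              (y d - y d.+1) ^+ 2
  <= \sum_i dispersion (A (T + t)%N i) (fun j => x (T + t)%N j ord0).
Proof.
set E := fun d => ~~ crossed t d && crossing (T + t) d.
pose g (d : 'I_n) := (y d - y d.+1) ^+ 2.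
apply: (@le_trans _ _ (\sum_i \sum_(d < n | E d)
    g d * dispersion (fun j => A (T + t)%N i (s j))
            (fun j : 'I_n.+1 => (j <= d)%:R))).
  rewrite exchange_big mulr_sumr /=; apply: ler_sum => d /andP[_ cr].
  rewrite -mulr_sumr mulrC ler_wpM2l ?sqr_ge0 //.
  exact: dispersion_crossing.
apply: ler_sum => i _.
rewrite -[leRHS](dispersion_perm s).
apply: dispersion_sum_le => // {}i j.
wlog ij : i j / (i <= j)%N.
  move=> IH; case/orP: (leq_total i j) => /IH // h.
  rewrite -sqrrN opprB; apply: le_trans h; apply: ler_sum => d _.
  by rewrite -[X in _ * X]sqrrN opprB.
(* The indicators differ exactly when cut [d] separates positions [i] and [j]. *)
have -> : \sum_(d < n | E d) g d * ((i <= d)%:R - (j <= d)%:R) ^+ 2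
    = \sum_(d < n | E d && (i <= d < j)%N) g d.
  rewrite [RHS]big_mkcondr; apply: eq_bigr => d _.
  rewrite ltnNge; case: (leqP j d) => [jd|dj].
    by rewrite (leq_trans ij jd) subrr expr0n mulr0 andbF.
  by case: (i <= d)%N; rewrite subr0 ?expr1n ?mulr1 ?expr0n ?mulr0.
apply: (@sum_gaps_sqr_le _ y (fun d => E d && (i <= d < j)%N)).
  exact: sorted_value_mono.
move=> d dn /andP[/andP[ncr _] /andP[id dj]]; split.
  by have := uncrossed_separates i dn ncr; rewrite id.
by have := uncrossed_separates j dn ncr; rewrite leqNgt dj.
Qed.

(** Each cut is charged only at its first crossing, so the decreases of successive steps add up
    without double counting. *)
Lemma Vlow_crossed t :
  Vlow (x (T + t)%N) <=
  Vlow (x T) - eta / 2 * \sum_(d < n | crossed t d) (y d - y d.+1) ^+ 2.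
Proof.
elim: t => [|t IHt].
  by rewrite addn0 big_pred0 ?mulr0 ?subr0.
rewrite addnS; apply: le_trans (Vlow_succ _) _.
have -> : \sum_(d < n | crossed t.+1 d) (y d - y d.+1) ^+ 2 =
    \sum_(d < n | crossed t d) (y d - y d.+1) ^+ 2 +
    \sum_(d < n | ~~ crossed t d && crossing (T + t) d) (y d - y d.+1) ^+ 2.
  rewrite (bigID (fun d : 'I_n => crossed t d)) /=; congr (_ + _).
    by apply: eq_bigl => d; rewrite crossedS; case: (crossed t d) => //=;
      rewrite ?andbT ?andbF.
  by apply: eq_bigl => d; rewrite crossedS; case: (crossed t d) => //=;
      rewrite ?andbT ?andbF.
have := first_crossing_dispersion t; rewrite mulrDr; lra.
Qed.

(** Every deviation is at most [y 0 - y n], a telescoping sum of [n] gaps. Cauchy-Schwarz costs a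
    factor [n], and summing over the nodes a factor [n.+1]. *)
Lemma Vlow_le_gaps :
  Vlow (x T) <= n.+1%:R ^+ 2 * \sum_(d < n) (y d - y d.+1) ^+ 2.
Proof.
have y_le_minc : y n <= minc (x T).
  apply: minc_ge => i; rewrite -(permKV s i); apply: s_sorts.
  by rewrite inordK // -ltnS.
set G := \sum_(d < n) _.
have G0 : 0 <= G by apply: sumr_ge0 => d _; exact: sqr_ge0.
have y0n : (y 0%N - y n) ^+ 2 <= n%:R * G.
  have -> : y 0%N - y n = \sum_(d < n) (y d - y d.+1).
    rewrite -(big_mkord predT (fun d => y d - y d.+1)) /= -opprB.
    rewrite -(telescope_sumr y (leq0n n)) -sumrN.
    by apply: eq_bigr => d _; rewrite opprB.
  by rewrite -[X in X%:R]card_ord; exact: sumr_sqr_le.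
apply: le_trans (Vlow_le y_le_minc) _.
apply: (@le_trans _ _ (\sum_(i < n.+1) n%:R * G)).
  apply: ler_sum => i _; apply: le_trans y0n.
  have le0 : y n <= x T i ord0.
    exact: le_trans y_le_minc (minc_le _ _).
  have le1 : x T i ord0 <= y 0%N.
    by rewrite -(permKV s i); apply: s_sorts; rewrite inordK.
  by rewrite ler_pXn2r ?nnegrE ?subr_ge0 ?lerB // (le_trans le0).
rewrite sumr_const card_ord -[leLHS]mulr_natl mulrA expr2 ler_wpM2r //.
by rewrite ler_wpM2l ?ler0n ?ler_nat.
Qed.

Lemma Vlow_all_crossed B :
    (forall d, (d < n)%N -> y d = y d.+1 \/ crossed B d) ->
  Vlow (x (T + B)%N) <= (1 - eta / (2 * n.+1%:R ^+ 2)) * Vlow (x T).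
Proof.
move=> all_cr; apply: le_trans (Vlow_crossed B) _.
(* A cut not crossed in the window is a tie, with gap 0. *)
have -> : \sum_(d < n | crossed B d) (y d - y d.+1) ^+ 2 =
          \sum_(d < n) (y d - y d.+1) ^+ 2.
  rewrite big_mkcond; apply: eq_bigr => d _.
  case: ifPn => // ncr; case: (all_cr d (ltn_ord d)) => [->|].
    by rewrite subrr expr0n.
  by rewrite (negPf ncr).
have N0 : 0 < n.+1%:R ^+ 2 :> R by rewrite exprn_gt0 ?ltr0n.
have := Vlow_le_gaps; rewrite -ler_pdivrMl // => gaps.
have -> : eta / (2 * n.+1%:R ^+ 2) = eta / 2 * (n.+1%:R ^+ 2)^-1.
  by rewrite invfM mulrA.
rewrite mulrBl mul1r lerD2l lerN2.
by rewrite -[_ * _ * Vlow _]mulrA ler_pM2l ?divr_gt0.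
Qed.

End Window.

(** * Sorting, and geometric decay over successive windows *)

Lemma exists_sorting_perm (d : Order.disp_t) (D : orderType d) (n : nat)
    (f : 'I_n -> D) :
  exists s : {perm 'I_n}, forall p q : 'I_n, (p <= q)%N -> (f (s q) <= f (s p))%O.
Proof.
pose t := [tuple f i | i < n].
have /tuple_permP[s sE] : perm_eq (sort >=%O t) t by rewrite perm_sort.
exists s => p q pq.
have srt : sorted >=%O (sort >=%O t).
  by apply: sort_sorted => a b; exact: le_total.
have sz : size (sort >=%O t) = n by rewrite size_sort size_tuple.
have nthE (i : 'I_n) : nth (f p) (sort >=%O t) i = f (s i).
  by rewrite sE -tnth_nth tnth_mktuple tnth_mktuple.
rewrite -!nthE; apply: (sorted_leq_nth _ _ _ srt) => //.
- by move=> a b c /= ab ca; exact: le_trans ca ab.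
- exact: lexx.
- by rewrite inE sz.
- by rewrite inE sz.
Qed.

(* The number of nodes is n.+1.  The premise [eps < 1 -> B <= k] excludes only
   times before the end of the first connectivity window: there the matrices
   may all be the identity, so no decrease can be claimed, although the
   threshold on k tends to 0 as eps tends to 1. *)
Theorem theorem7p1 (R : realType) :
  exists c : R,
    forall (n B Q : nat) (eta : R) (A : nat -> 'M[R]_n.+1)
           (x : nat -> 'cV[R]_n.+1),
      (1 <= B)%N -> (1 <= Q)%N -> 0 < eta ->
      nonvanishing_weights eta A ->
      column_stochastic A ->
      (forall i : 'I_n.+1, quantum_multiple Q (x 0%N i ord0)) ->
      quantized_averaging Q A x ->
      relaxed_connectivity B A x ->
      forall eps : R, 0 < eps ->
      forall k : nat, (eps < 1 -> (B <= k)%N) ->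
        c * (n.+1%:R ^+ 2 / eta) * B%:R * ln (1 / eps) <= k%:R ->
        Vlow (x k) <= eps * Vlow (x 0%N).
Proof.
(* One factor 2 comes from the rate [r], the other from the incomplete last window. *)
exists 4 => n B Q eta A x B1 Q1 eta0 wA cA q0 xS conn eps eps0 k Bk.
have V0 : 0 <= Vlow (x 0%N) by apply: sumr_ge0 => i _; exact: sqr_ge0.
have Vmono := Vlow_nonincreasing Q1 wA cA q0 xS.
have [eps_ge1 _|eps_lt1] := leP 1 eps.
  apply: le_trans (Vmono _ _ (leq0n k)) _.
  by rewrite ler_peMl.
have {}Bk := Bk eps_lt1.
set r : R := eta / (2 * n.+1%:R ^+ 2).
have N0 : 0 < n.+1%:R ^+ 2 :> R by rewrite exprn_gt0 ?ltr0n.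
have window l : Vlow (x (l * B + B)%N) <= (1 - r) * Vlow (x (l * B)%N).
  have [s sP] := exists_sorting_perm (fun i => x (l * B)%N i ord0).
  apply: (Vlow_all_crossed Q1 eta0 wA cA q0 xS sP) => d dn.
  have := conn l s sP (inord d) (inord d.+1).
  rewrite !inordK // 1?ltnW // => /(_ erefl)[eq_y|]; first by left.
  move=> [t [/andP[lt tl] [i [j [id dj Aij]]]]]; right.
  apply/hasP; exists (t - l * B)%N.
    by rewrite mem_iota add0n /= ltn_subLR // -mulSnr.
  rewrite subnKC //; apply/existsP; exists i; apply/existsP; exists j.
  by rewrite id dj; apply/orP.
(* Bounding [1 - r] by [expR (- r)] lets the target be compared through [ln eps]. *)
have geom l : Vlow (x (l * B)%N) <= expR (- r * l%:R) * Vlow (x 0%N).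
  elim: l => [|l IHl]; first by rewrite mul0n mulr0 expR0 mul1r.
  rewrite mulSnr; apply: le_trans (window l) _.
  have V0l : 0 <= Vlow (x (l * B)%N) by apply: sumr_ge0 => i _; exact: sqr_ge0.
  rewrite -nat1r mulrDr mulr1 expRD -mulrA.
  apply: le_trans (ler_wpM2r V0l (expR_ge1Dx _)) _.
  by rewrite ler_wpM2l ?expR_ge0.
move=> k_large; apply: le_trans (Vmono _ _ (leq_divM k B)) _.
apply: le_trans (geom _) _; apply: ler_wpM2r => //.
rewrite -[eps]lnK ?posrE // ler_expR.
(* Since [B <= k], at least one window is complete, so the incomplete one at most doubles the
   time. *)
have kB : (k <= 2 * (k %/ B) * B)%N.
  have := divn_eq k B; have := ltn_pmod k B1; have : (0 < k %/ B)%N by rewrite divn_gt0.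
  nia.
have {}kB : k%:R <= 2 * (k %/ B)%:R * B%:R :> R by rewrite -!natrM ler_nat.
move: k_large; rewrite div1r lnV ?posrE // => k_large.
have B0 : 0 < B%:R :> R by rewrite ltr0n.
(* By the value of [r], the right side is exactly [2 * (k %/ B) * B]. *)
have h : (4 * (n.+1%:R ^+ 2 / eta) * B%:R) * - ln eps
   <= (4 * (n.+1%:R ^+ 2 / eta) * B%:R) * (r * (k %/ B)%:R).
  apply: le_trans k_large _; apply: le_trans kB _.
  rewrite le_eqVlt; apply/orP; left; apply/eqP; rewrite /r; field.
  by rewrite nat1r !gt_eqF ?ltr0n.
rewrite ler_pM2l in h; first lra.
by apply: mulr_gt0 => //; apply: mulr_gt0 => //; exact: divr_gt0.
Qed.
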